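(* Let $\mathbf{h}$ be a cocommutative connected bimonoid in species over a field $\Bbbk$, let $I$ be a nonempty finite set, and let $z=\sum_{F\vDash I}a_F\mathtt{H}_F\in\mathbf{\Sigma}[I]$ with $a_F\in\Bbbk$. (i) If $z\in\mathcal{P}(\mathbf{\Sigma})[I]$, then $\Psi_I(z)(\mathbf{h}[I])\subseteq\mathcal{P}(\mathbf{h})[I]$. (ii) If in addition $a_{(I)}\neq0$, then $\Psi_I(a_{(I)}^{-1}z)$ is a projection from $\mathbf{h}[I]$ onto $\mathcal{P}(\mathbf{h})[I]$.
   Context: Species and bimonoids. A species is a functor $\mathbf{p}$ from the category of finite sets and bijections to $\Bbbk$-vector spaces; morphisms are natural transformations. $I=S\sqcup T$ means that $(S,T)$ is an ordered pair of disjoint, possibly empty, subsets with union $I$. The Cauchy product is $(\mathbf{p}\cdot\mathbf{q})[I]=\bigoplus_{I=S\sqcup T}\mathbf{p}[S]\otimes\mathbf{q}[T]$; with the symmetry $x\otimes y\mapsto y\otimes x$ and unit the species that is $\Bbbk$ on $\emptyset$ and $0$ elsewhere, species form a symmetric monoidal category. Monoids, comonoids and bimonoids are taken in this category, with structure maps $\mu_{S,T},\iota_\emptyset$ (product $\mathbf{a}[S]\otimes\mathbf{a}[T]\to\mathbf{a}[I]$, unit) and $\Delta_{S,T},\epsilon_\emptyset$ (coproduct $\mathbf{c}[I]\to\mathbf{c}[S]\otimes\mathbf{c}[T]$, counit); in a bimonoid, product and unit are morphisms of comonoids. Cocommutative means that $\Delta_{T,S}$ equals $\Delta_{S,T}$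 followed by the swap. A bimonoid is connected if $\dim\mathbf{h}[\emptyset]=1$. A composition $F=(I_1,\dots,I_k)\vDash I$ is a sequence of pairwise disjoint nonempty subsets with union $I$. $\mu_F:\mathbf{h}[I_1]\otimes\cdots\otimes\mathbf{h}[I_k]\to\mathbf{h}[I]$ and $\Delta_F:\mathbf{h}[I]\to\mathbf{h}[I_1]\otimes\cdots\otimes\mathbf{h}[I_k]$ are the iterated product and coproduct (identities for $k=1$). $\mathbf{\Sigma}$ is the connected bimonoid with $\mathbf{\Sigma}[I]$ having basis $\mathtt{H}_F$, $F\vDash I$, product $\mu_{S,T}(\mathtt{H}_{F}\otimes\mathtt{H}_{G})=\mathtt{H}_{F\cdot G}$ (concatenation), and coproduct $\Delta_{S,T}(\mathtt{H}_F)=\mathtt{H}_{F|_S}\otimes\mathtt{H}_{F|_T}$, where $F|_S$ is the list of nonempty $I_i\cap S$ in order. $(I)$ is the composition with one block. The primitive part of a connected comonoid $\mathbf{c}$ is $\mathcal{P}(\mathbf{c})[I]=\bigcap_{I=S\sqcup T,\ S,T\neq\emptyset}\ker\Delta_{S,T}$ for $I\ne\emptyset$. For $z=\sum_F a_F\mathtt{H}_F\in\mathbf{\Sigma}[I]$, $\Psi_I(z):\mathbf{h}[I]\to\mathbf{h}[I]$ is the linear map $\Psi_I(z)(h)=z\triangleright h:=\sum_{F\vDash I}a_F\,\mu_F\Delta_F(h)$. A projection onto a subspace is an idempotent linear map with image that subspace. *)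

(* Defs.v *)
From HB Require Import structures.
From mathcomp Require Import all_boot all_order all_algebra finmap.
From mathcomp Require Import generic_quotient ring_quotient.
From mathcomp Require Import freeg.
From mathcomp Require Import boolp.

Set Implicit Arguments.
Unset Strict Implicit.
Unset Printing Implicit Defensive.

Import GRing.Theory.
Local Open Scope ring_scope.
Local Open Scope quotient_scope.

Section FreeModule.
Variables (k : fieldType) (K : choiceType).

Lemma freeg_ind (P : {freeg K / k} -> Prop) :
  P 0 -> (forall a x D, P D -> P (a *: << x >> + D)) -> forall D, P D.
Proof.
move=> P0 PS D; rewrite -[D]freeg_sumE.
elim: (dom D) => [|x s IHs]; first by rewrite big_nil.
rewrite big_cons.
suff -> : << coeff x D *g x >> = coeff x D *: << x >> :> {freeg K / k}.
  exact: PS.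
by apply/eqP/freeg_eqP=> y; rewrite coeffZ !coeffU mul1r.
Qed.

Section Extension.
Variables (M : lmodType k) (f : K -> M).

(* The linear extension of f along the basis << x >> of {freeg K / k}. *)
Definition flin (D : {freeg K / k}) : M := fglift f D.

Lemma flinU x : flin << x >> = f x.
Proof. by rewrite /flin liftU scale1r. Qed.

Lemma flin_is_zmod_morphism : zmod_morphism flin.
Proof. exact: lift_is_additive. Qed.

HB.instance Definition _ :=
  GRing.isZmodMorphism.Build {freeg K / k} M flin flin_is_zmod_morphism.

Lemma flin_is_scalable : scalable flin.
Proof.
move=> a D; have flinZ b x : flin << b *g x >> = b *: f x by exact: liftU.
rewrite -[a *: D]/(fgscale a D) /fgscale -[D in RHS]freeg_sumE.
rewrite (raddf_sum flin) [in RHS](raddf_sum flin) scaler_sumr.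
by apply: eq_bigr => x _; rewrite /= !flinZ scalerA.
Qed.

HB.instance Definition _ :=
  GRing.isScalable.Build k {freeg K / k} M _ flin flin_is_scalable.

Lemma flinE D : flin D = \sum_(x <- dom D) coeff x D *: f x.
Proof.
rewrite -{1}[D]freeg_sumE raddf_sum; apply: eq_bigr => x _; exact: liftU.
Qed.

End Extension.

Lemma freeg_ext (M : lmodType k) (f g : {linear {freeg K / k} -> M}) :
  (forall x, f << x >> = g << x >>) -> f =1 g.
Proof.
move=> fg; elim/freeg_ind=> [|a x D IH]; first by rewrite !raddf0.
by rewrite !linearP IH fg.
Qed.

End FreeModule.

Section Tensor.
Variables (k : fieldType) (V W : lmodType k).

(* The span of the bilinearity relations in the free vector space on V * W. *)
Inductive tensor_rel : {freeg (V * W)%type / k} -> Prop :=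
| TRel0 : tensor_rel 0
| TRelP a D E : tensor_rel D -> tensor_rel E -> tensor_rel (a *: D + E)
| TRell a v v' w : tensor_rel
    (<< (a *: v + v', w) >> - (a *: << (v, w) >> + << (v', w) >>))
| TRelr a v w w' : tensor_rel
    (<< (v, a *: w + w') >> - (a *: << (v, w) >> + << (v, w') >>)).

Definition tensor_relb (D : {freeg (V * W)%type / k}) : bool :=
  `[< tensor_rel D >].

Lemma tensor_relb_zmod_closed : zmod_closed tensor_relb.
Proof.
split=> [|D E /asboolP DR /asboolP ER]; apply/asboolP; first exact: TRel0.
by rewrite addrC -scaleN1r; apply: TRelP.
Qed.

Let tensor_relz : zmodClosed {freeg (V * W)%type / k} :=
  HB.pack_for (zmodClosed {freeg (V * W)%type / k}) tensor_relb
    (GRing.isZmodClosed.Build {freeg (V * W)%type / k} tensor_relb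
       tensor_relb_zmod_closed).

Definition tensor_type := Quotient.quot tensor_relz.
HB.instance Definition _ := GRing.Zmodule.on tensor_type.

Definition tpi (D : {freeg (V * W)%type / k}) : tensor_type :=
  \pi_(Quotient.quot tensor_relz) D.

Lemma tpiP D E : tpi D = tpi E <-> tensor_rel (D - E).
Proof.
rewrite /tpi; split=> [/eqP|] h.
  by move: h; rewrite -Quotient.idealrBE => /asboolP.
by apply/eqP; rewrite -Quotient.idealrBE; apply/asboolP.
Qed.

Lemma tpiK t : tpi (repr t) = t.
Proof. exact: reprK. Qed.

Lemma tpiD : {morph tpi : D E / D + E}.
Proof. by move=> D E; rewrite /tpi !piE. Qed.

Definition tscale (a : k) (t : tensor_type) : tensor_type := tpi (a *: repr t).

Lemma tpiZ a D : tpi (a *: D) = tscale a (tpi D).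
Proof.
apply/tpiP; rewrite -scalerBr -[_ *: _]addr0; apply: TRelP; last exact: TRel0.
by apply/tpiP; rewrite tpiK.
Qed.

Lemma tscaleA a b t : tscale a (tscale b t) = tscale (a * b) t.
Proof. by rewrite -[t]tpiK -!tpiZ scalerA. Qed.
Lemma tscale1 : left_id 1 tscale.
Proof. by move=> t; rewrite -[t]tpiK -!tpiZ scale1r. Qed.
Lemma tscaleDr : right_distributive tscale +%R.
Proof.
by move=> a s t; rewrite -[s]tpiK -[t]tpiK -!(tpiD, tpiZ) scalerDr.
Qed.
Lemma tscaleDl t : {morph tscale^~ t : a b / a + b}.
Proof. by move=> a b; rewrite -[t]tpiK -!(tpiD, tpiZ) scalerDl. Qed.

HB.instance Definition _ :=
  GRing.Zmodule_isLmodule.Build k tensor_type tscaleA tscale1 tscaleDr tscaleDl.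

Definition tensor : lmodType k := tensor_type.

Definition tens (v : V) (w : W) : tensor := tpi << (v, w) >>.

Lemma scale_tpi a D : a *: (tpi D : tensor) = tpi (a *: D).
Proof. by rewrite tpiZ. Qed.

Lemma tens_linearl w : linear (tens^~ w).
Proof.
by move=> a v v'; rewrite /tens scale_tpi -[RHS]tpiD; apply/tpiP; apply: TRell.
Qed.

Lemma tens_linearr v : linear (tens v).
Proof.
by move=> a w w'; rewrite /tens scale_tpi -[RHS]tpiD; apply/tpiP; apply: TRelr.
Qed.

HB.instance Definition _ v :=
  GRing.isLinear.Build k W tensor _ (tens v) (tens_linearr v).

Lemma tensor_ind (P : tensor -> Prop) :
  P 0 -> (forall a v w t, P t -> P (a *: tens v w + t)) -> forall t, P t.
Proof.
move=> P0 PS t; rewrite -[t]tpiK; elim/freeg_ind: (repr t) => [|a [v w] D IH].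
  suff -> : tpi 0 = 0 by [].
  by apply: (@addrI _ (tpi 0)); rewrite -tpiD !addr0.
by rewrite tpiD -scale_tpi; apply: PS.
Qed.

Lemma tensor_ext (X : lmodType k) (f g : {linear tensor -> X}) :
  (forall v w, f (tens v w) = g (tens v w)) -> f =1 g.
Proof.
move=> fg; elim/tensor_ind=> [|a v w t IH]; first by rewrite !raddf0.
by rewrite !linearP IH fg.
Qed.

Definition bilin (X : lmodType k) (f : V -> W -> X) : Prop :=
  (forall w, linear (f^~ w)) /\ (forall v, linear (f v)).

Section Lift.
Variables (X : lmodType k) (f : V -> W -> X) (fP : bilin f).

Let flf (D : {freeg (V * W)%type / k}) : X := flin (fun p => f p.1 p.2) D.

Let flf_rel D : tensor_rel D -> flf D = 0.
Proof.
rewrite /flf; case: fP => fl fr.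
elim=> [|a D1 D2 _ IH1 _ IH2|a v v' w|a v w w'].
- exact: raddf0.
- by rewrite linearP /= IH1 IH2 scaler0 addr0.
- by rewrite linearB linearP /= !flinU /= fl subrr.
- by rewrite linearB linearP /= !flinU /= fr subrr.
Qed.

Definition tlift (_ : bilin f) (t : tensor) : X := flf (repr t).

Let tlift_pi D : tlift fP (tpi D) = flf D.
Proof.
apply/eqP; rewrite -subr_eq0 /tlift /flf -raddfB; apply/eqP.
by apply: flf_rel; apply/tpiP; rewrite tpiK.
Qed.

Lemma tlift_is_linear : linear (tlift fP).
Proof.
move=> a s t; rewrite -[s]tpiK -[t]tpiK scale_tpi -tpiD !tlift_pi.
exact: linearP.
Qed.

HB.instance Definition _ := GRing.isLinear.Build k tensor X _ (tlift fP)
  tlift_is_linear.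

Lemma tliftE v w : tlift fP (tens v w) = f v w.
Proof. by rewrite tlift_pi /flf flinU. Qed.

End Lift.
End Tensor.

Section TensorMaps.
Variable k : fieldType.
Implicit Types V W X Y : lmodType k.

Lemma tensDl V W (v v' : V) (w : W) : tens (v + v') w = tens v w + tens v' w.
Proof. by have := tens_linearl w 1 v v'; rewrite !scale1r. Qed.
Lemma tensZl V W a (v : V) (w : W) : tens (a *: v) w = a *: tens v w.
Proof.
have t0 : tens (0 : V) w = 0.
  by apply: (@addrI _ (tens 0 w)); rewrite -tensDl !addr0.
by have := tens_linearl w a v 0; rewrite t0 !addr0.
Qed.
Lemma tensDr V W (v : V) (w w' : W) : tens v (w + w') = tens v w + tens v w'.
Proof. by have := tens_linearr v 1 w w'; rewrite !scale1r. Qed.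
Lemma tensZr V W a (v : V) (w : W) : tens v (a *: w) = a *: tens v w.
Proof.
have t0 : tens v (0 : W) = 0.
  by apply: (@addrI _ (tens v 0)); rewrite -tensDr !addr0.
by have := tens_linearr v a w 0; rewrite t0 !addr0.
Qed.

Lemma tens0l V W (w : W) : tens (0 : V) w = 0.
Proof. by rewrite -[X in tens X _](scale0r 0) tensZl scale0r. Qed.
Lemma tens0r V W (v : V) : tens v (0 : W) = 0.
Proof. by rewrite -[X in tens _ X](scale0r 0) tensZr scale0r. Qed.

Lemma tmap_bilin V W X Y (f : {linear V -> X}) (g : {linear W -> Y}) :
  bilin (fun v w => tens (f v) (g w)).
Proof.
by split=> [w a v v'|v a w w'] /=; rewrite linearP ?tens_linearl ?tens_linearr.
Qed.
Definition tmap V W X Y (f : {linear V -> X}) (g : {linear W -> Y}) :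
  tensor V W -> tensor X Y := tlift (tmap_bilin f g).
HB.instance Definition _ V W X Y f g := GRing.Linear.copy (@tmap V W X Y f g)
  (tlift (tmap_bilin f g)).
Lemma tmapE V W X Y (f : {linear V -> X}) (g : {linear W -> Y}) v w :
  tmap f g (tens v w) = tens (f v) (g w).
Proof. exact: tliftE. Qed.

Lemma tswap_bilin V W : bilin (fun (v : V) (w : W) => tens w v).
Proof. by split=> [w|v]; [exact: tens_linearr | exact: tens_linearl]. Qed.
Definition tswap V W : tensor V W -> tensor W V := tlift (@tswap_bilin V W).
HB.instance Definition _ V W := GRing.Linear.copy (@tswap V W)
  (tlift (@tswap_bilin V W)).
Lemma tswapE V W (v : V) (w : W) : tswap (tens v w) = tens w v.
Proof. exact: tliftE. Qed.

Lemma tassoc_bilin1 V W X (x : X) :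
  bilin (fun (v : V) (w : W) => tens v (tens w x)).
Proof.
by split=> [w a v v'|v a w w'];
  rewrite ?tens_linearl ?tens_linearr ?tensDr ?tensZr.
Qed.
Lemma tassoc_bilin V W X :
  bilin (fun (t : tensor V W) (x : X) => tlift (@tassoc_bilin1 V W X x) t).
Proof.
split=> [x a t t'|t a x x'] /=; first exact: linearP.
elim/tensor_ind: t => [|b v w t IH]; first by rewrite !linear0 addr0.
rewrite !tlift_is_linear IH !tliftE /= !tens_linearr !scalerDr addrACA.
by rewrite !scalerA mulrC.
Qed.
(* The associator (V (x) W) (x) X -> V (x) (W (x) X). *)
Definition tassoc V W X :
    tensor (tensor V W) X -> tensor V (tensor W X) :=
  tlift (@tassoc_bilin V W X).
HB.instance Definition _ V W X := GRing.Linear.copy (@tassoc V W X)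
  (tlift (@tassoc_bilin V W X)).
Lemma tassocE V W X (v : V) (w : W) (x : X) :
  tassoc (tens (tens v w) x) = tens v (tens w x).
Proof. by rewrite [LHS]tliftE tliftE. Qed.

Lemma tassocV_bilin1 V W X (v : V) :
  bilin (fun (w : W) (x : X) => tens (tens v w) x).
Proof.
by split=> [x a w w'|w a x x'];
  rewrite ?tens_linearl ?tens_linearr ?tensDl ?tensZl.
Qed.
Lemma tassocV_bilin V W X :
  bilin (fun (v : V) (t : tensor W X) => tlift (@tassocV_bilin1 V W X v) t).
Proof.
split=> [t a v v'|v a t t'] /=; last exact: linearP.
elim/tensor_ind: t => [|b w x t IH]; first by rewrite !linear0 addr0.
rewrite !tlift_is_linear IH !tliftE /= !tens_linearl !scalerDr addrACA.
by rewrite !scalerA mulrC.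
Qed.
Definition tassocV V W X :
    tensor V (tensor W X) -> tensor (tensor V W) X :=
  tlift (@tassocV_bilin V W X).
HB.instance Definition _ V W X := GRing.Linear.copy (@tassocV V W X)
  (tlift (@tassocV_bilin V W X)).
Lemma tassocVE V W X (v : V) (w : W) (x : X) :
  tassocV (tens v (tens w x)) = tens (tens v w) x.
Proof. by rewrite [LHS]tliftE tliftE. Qed.

Definition kline V (v : V) (a : k^o) : V := (a : k) *: v.
Lemma kline_is_linear V (v : V) : linear (kline v).
Proof. by move=> a b c; rewrite /kline scalerDl scalerA. Qed.
HB.instance Definition _ V (v : V) :=
  GRing.isLinear.Build k k^o V _ (kline v) (kline_is_linear v).

Lemma tlunit_bilin V : @bilin k k^o V V (fun (a : k^o) (v : V) => (a : k) *: v).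
Proof.
split=> [v b a a'|a b v v'] /=; first by rewrite scalerDl scalerA.
by rewrite scalerDr !scalerA mulrC.
Qed.
(* The unitors k (x) V -> V and V (x) k -> V. *)
Definition tlunit V : tensor k^o V -> V := tlift (@tlunit_bilin V).
HB.instance Definition _ V := GRing.Linear.copy (@tlunit V)
  (tlift (@tlunit_bilin V)).
Lemma tlunitE V a (v : V) : tlunit (tens a v) = a *: v.
Proof. exact: tliftE. Qed.
Definition trunit V : tensor V k^o -> V := @tlunit V \o @tswap V k^o.
HB.instance Definition _ V := GRing.Linear.copy (@trunit V)
  (@tlunit V \o @tswap V k^o).
Lemma trunitE V a (v : V) : trunit (tens v a) = a *: v.
Proof. by rewrite /trunit /= tswapE tlunitE. Qed.

(* v1 (x) v2 (x) v3 (x) v4 |-> v1 (x) v3 (x) v2 (x) v4. *)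
Definition tmid V W X Y :
    tensor (tensor V W) (tensor X Y) -> tensor (tensor V X) (tensor W Y) :=
  @tassocV V X (tensor W Y)
  \o tmap idfun (@tassoc X W Y \o tmap (@tswap W X) idfun \o @tassocV W X Y)
  \o @tassoc V W (tensor X Y).
HB.instance Definition _ V W X Y := GRing.Linear.copy (@tmid V W X Y)
  (@tassocV V X (tensor W Y)
   \o tmap idfun (@tassoc X W Y \o tmap (@tswap W X) idfun \o @tassocV W X Y)
   \o @tassoc V W (tensor X Y)).
Lemma tmidE V W X Y (v : V) (w : W) (x : X) (y : Y) :
  tmid (tens (tens v w) (tens x y)) = tens (tens v x) (tens w y).
Proof.
by rewrite /tmid /= tassocE tmapE /= tassocVE tmapE /= tswapE tassocE tassocVE.
Qed.

End TensorMaps.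

Section Species.
Variables (k : fieldType) (U : choiceType).
Implicit Types I J K R S T : {fset U}.

(* I = S |_| T, where S and T may be empty. *)
Definition decomp I S T : bool := (I == S `|` T)%fset && [disjoint S & T]%fset.

(* The category of finite sets and bijections is realized as the finite subsets
   of an arbitrary type U; s : I -> J is a map between the types of elements of
   I and J. *)
Record species := Species {
  sp_obj :> {fset U} -> lmodType k;
  sp_map : forall I J (s : I -> J), bijective s ->
    {linear sp_obj I -> sp_obj J};
  sp_map_id : forall I (b : bijective (@id I)), sp_map b =1 id;
  sp_map_comp : forall I J K (s : I -> J) (t : J -> K) (bs : bijective s)
    (bt : bijective t) (bts : bijective (t \o s)),
    sp_map bts =1 sp_map bt \o sp_map bs }.

Definition restricts I J S S' (s : I -> J) (sS : S -> S') : Prop :=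
  forall (x : S) (y : I), fsval x = fsval y -> fsval (sS x) = fsval (s y).

(* A morphism from or to the Cauchy product h . h amounts to its components,
   indexed by the decompositions of I.  The unit species is k on the empty set
   and 0 elsewhere, so iota0 and eps0 are the only components of the unit and
   of the counit, and are natural because the identity is the only bijection
   of fset0. *)
Record monoid_on (h : species) := MonoidOn {
  mu : forall I S T, decomp I S T -> {linear tensor (h S) (h T) -> h I};
  iota0 : {linear k^o -> h fset0};
  mu_natural : forall I S T J S' T' (d : decomp I S T) (d' : decomp J S' T')
    (s : I -> J) (sS : S -> S') (sT : T -> T')
    (b : bijective s) (bS : bijective sS) (bT : bijective sT),
    restricts s sS -> restricts s sT ->
    sp_map h b \o mu d =1 mu d' \o tmap (sp_map h bS) (sp_map h bT);
  mu_assoc : forall I J K R S T (dJ : decomp J R S) (d : decomp I J T)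
    (dK : decomp K S T) (d' : decomp I R K),
    mu d \o tmap (mu dJ) idfun =1
    mu d' \o tmap idfun (mu dK) \o @tassoc k (h R) (h S) (h T);
  mu_unitl : forall I (d : decomp I fset0 I),
    mu d \o tmap iota0 idfun =1 @tlunit k (h I);
  mu_unitr : forall I (d : decomp I I fset0),
    mu d \o tmap idfun iota0 =1 @trunit k (h I) }.

Record comonoid_on (h : species) := ComonoidOn {
  Delta : forall I S T, decomp I S T -> {linear h I -> tensor (h S) (h T)};
  eps0 : {linear h fset0 -> k^o};
  Delta_natural : forall I S T J S' T' (d : decomp I S T) (d' : decomp J S' T')
    (s : I -> J) (sS : S -> S') (sT : T -> T')
    (b : bijective s) (bS : bijective sS) (bT : bijective sT),
    restricts s sS -> restricts s sT ->
    Delta d' \o sp_map h b =1 tmap (sp_map h bS) (sp_map h bT) \o Delta d;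
  Delta_coassoc : forall I J K R S T (dJ : decomp J R S) (d : decomp I J T)
    (dK : decomp K S T) (d' : decomp I R K),
    @tassoc k (h R) (h S) (h T) \o tmap (Delta dJ) idfun \o Delta d =1
    tmap idfun (Delta dK) \o Delta d';
  Delta_counitl : forall I (d : decomp I fset0 I),
    @tlunit k (h I) \o tmap eps0 idfun \o Delta d =1 id;
  Delta_counitr : forall I (d : decomp I I fset0),
    @trunit k (h I) \o tmap idfun eps0 \o Delta d =1 id }.

(* The four axioms say that the product and the unit are morphisms of
   comonoids.  In Delta_mu, the decompositions force A = S `&` S',
   B = S `&` T', C = T `&` S' and D = T `&` T'. *)
Record bimonoid := Bimonoid {
  bm_species :> species;
  bm_monoid :> monoid_on bm_species;
  bm_comonoid :> comonoid_on bm_species;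
  Delta_mu : forall I S T S' T' A B C D
    (d : decomp I S T) (d' : decomp I S' T')
    (dS : decomp S A B) (dT : decomp T C D)
    (dS' : decomp S' A C) (dT' : decomp T' B D),
    Delta bm_comonoid d' \o mu bm_monoid d =1
    tmap (mu bm_monoid dS') (mu bm_monoid dT') \o @tmid k _ _ _ _
    \o tmap (Delta bm_comonoid dS) (Delta bm_comonoid dT);
  Delta_iota : forall d : decomp fset0 fset0 fset0,
    Delta bm_comonoid d (iota0 bm_monoid 1) =
    tens (iota0 bm_monoid 1) (iota0 bm_monoid 1);
  eps_mu : forall d : decomp fset0 fset0 fset0,
    eps0 bm_comonoid \o mu bm_monoid d =1
    @tlunit k k^o \o tmap (eps0 bm_comonoid) (eps0 bm_comonoid);
  eps_iota : eps0 bm_comonoid \o iota0 bm_monoid =1 id }.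

Definition cocommutative (h : species) (c : comonoid_on h) : Prop :=
  forall I S T (d : decomp I S T) (d' : decomp I T S),
    Delta c d' =1 @tswap k (h S) (h T) \o Delta c d.

(* dim h[fset0] = 1 *)
Definition connected (h : species) : Prop :=
  exists2 e : h fset0, e != 0 & forall x, exists a, x = a *: e.

(* The primitive part P(h)[I]; only meaningful for I nonempty. *)
Definition primitive (h : species) (c : comonoid_on h) I (x : h I) : Prop :=
  forall S T (d : decomp I S T), S != fset0 -> T != fset0 -> Delta c d x = 0.

Definition is_comp I (F : seq {fset U}) : bool :=
  [&& all (fun S => S != fset0) F, pairwise (@fdisjoint U) F
    & (\bigcup_(S <- F) S == I)%fset].

Definition composition I := {F : seq {fset U} | is_comp I F}.
HB.instance Definition _ I := SubChoice.on (composition I).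

Lemma is_comp_nil I : is_comp I [::] -> fset0 = I.
Proof. by rewrite /is_comp /= big_nil => /eqP. Qed.

Lemma is_comp_seq1 I S : is_comp I [:: S] -> S = I.
Proof. by rewrite /is_comp /= big_seq1 => /andP[_ /eqP]. Qed.

Lemma is_comp_cons I S F :
  is_comp I (S :: F) =
  [&& S != fset0, decomp I S (I `\` S)%fset & is_comp (I `\` S)%fset F].
Proof.
rewrite /is_comp /decomp /= big_cons.
have -> : all (fdisjoint S) F = [disjoint S & \bigcup_(T <- F) T]%fset.
  apply/allP/fdisjointP=> [h x xS|h T TF].
    apply/bigfcupP=> -[T /andP[TF _]]; apply/negP; exact: (fdisjointP (h _ TF)).
  apply/fdisjointP=> x /h; apply: contra => xT; apply/bigfcupP.
  by exists T; rewrite ?TF.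
set B := (\bigcup_(T <- F) T)%fset.
apply/and3P/and3P=> [[/andP[S0 F0] /andP[dSB dF] /eqP <-]|].
  have -> : ((S `|` B) `\` S = B)%fset.
    apply/fsetP=> x; rewrite !inE; case xS: (x \in S) => //=.
    by rewrite (negPf (fdisjointP dSB _ xS)).
  by split; rewrite ?S0 ?eqxx ?dSB ?F0 ?dF.
case=> S0 /andP[/eqP ISI dSI] /and3P[F0 dF /eqP ->].
by split; rewrite ?S0 ?F0 ?dF ?dSI -?ISI.
Qed.

Lemma is_comp_decomp I S F : is_comp I (S :: F) -> decomp I S (I `\` S)%fset.
Proof. by rewrite is_comp_cons => /and3P[]. Qed.

Lemma is_comp_behead I S F : is_comp I (S :: F) -> is_comp (I `\` S)%fset F.
Proof. by rewrite is_comp_cons => /and3P[]. Qed.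

Section Iterated.
Variable h : bimonoid.

Definition sp_cast I J (e : I = J) : {linear h I -> h J} :=
  match e in _ = J return {linear h I -> h J} with erefl => idfun end.

(* h[I_1] (x) (h[I_2] (x) (... (x) h[I_k])), which is h[I_1] for k = 1. *)
Fixpoint tens_seq (F : seq {fset U}) : lmodType k :=
  match F with
  | [::] => k^o
  | B :: F' => if F' is [::] then h B else tensor (h B) (tens_seq F')
  end.

Fixpoint mu_seq F : forall I, is_comp I F -> {linear tens_seq F -> h I} :=
  match F return forall I, is_comp I F -> {linear tens_seq F -> h I} with
  | [::] => fun I c => sp_cast (is_comp_nil c) \o iota0 h
  | B :: F' =>
    match F' return (forall I, is_comp I F' -> {linear tens_seq F' -> h I}) ->
      forall I, is_comp I (B :: F') -> {linear tens_seq (B :: F') -> h I} with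
    | [::] => fun _ I c => sp_cast (is_comp_seq1 c)
    | _ :: _ => fun mu_F' I c =>
      mu h (is_comp_decomp c) \o tmap idfun (mu_F' _ (is_comp_behead c))
    end (@mu_seq F')
  end.

Fixpoint Delta_seq F : forall I, is_comp I F -> {linear h I -> tens_seq F} :=
  match F return forall I, is_comp I F -> {linear h I -> tens_seq F} with
  | [::] => fun I c => eps0 h \o sp_cast (esym (is_comp_nil c))
  | B :: F' =>
    match F' return (forall I, is_comp I F' -> {linear h I -> tens_seq F'}) ->
      forall I, is_comp I (B :: F') -> {linear h I -> tens_seq (B :: F')} with
    | [::] => fun _ I c => sp_cast (esym (is_comp_seq1 c))
    | _ :: _ => fun Delta_F' I c =>
      tmap idfun (Delta_F' _ (is_comp_behead c)) \o Delta h (is_comp_decomp c)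
    end (@Delta_seq F')
  end.

Definition mu_comp I (F : composition I) := mu_seq (valP F).
Definition Delta_comp I (F : composition I) := Delta_seq (valP F).

End Iterated.
End Species.

Section TensorBasis.
Variables (k : fieldType) (K L M : choiceType) (X : lmodType k).

Lemma tens_basis_ext (f g : {linear tensor {freeg K / k} {freeg L / k} -> X}) :
  (forall x y, f (tens << x >> << y >>) = g (tens << x >> << y >>)) -> f =1 g.
Proof.
move=> fg; apply: tensor_ext => D E.
elim/freeg_ind: D => [|a x D IH].
  by rewrite !(tens0l, tens0r) (linear0 f) (linear0 g).
rewrite tens_linearl (linearP f) (linearP g) IH; congr (_ *: _ + _).
elim/freeg_ind: E {IH} => [|b y E IH].
  by rewrite !(tens0l, tens0r) (linear0 f) (linear0 g).
by rewrite tens_linearr (linearP f) (linearP g) IH fg.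
Qed.

Lemma tens_basis_ext3
  (f g : {linear tensor (tensor {freeg K / k} {freeg L / k}) {freeg M / k} ->
                 X}) :
  (forall x y z, f (tens (tens << x >> << y >>) << z >>) =
                 g (tens (tens << x >> << y >>) << z >>)) -> f =1 g.
Proof.
move=> fg; apply: tensor_ext => t E.
elim/freeg_ind: E => [|b z E IH].
  by rewrite !(tens0l, tens0r) (linear0 f) (linear0 g).
rewrite tens_linearr (linearP f) (linearP g) IH; congr (_ *: _ + _).
elim/tensor_ind: t {IH} => [|a D D' t IH].
  by rewrite !(tens0l, tens0r) (linear0 f) (linear0 g).
rewrite tens_linearl (linearP f) (linearP g) IH; congr (_ *: _ + _).
elim/freeg_ind: D {IH} => [|c x D IH].
  by rewrite !(tens0l, tens0r) (linear0 f) (linear0 g).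
rewrite !tens_linearl (linearP f) (linearP g) IH; congr (_ *: _ + _).
elim/freeg_ind: D' {IH} => [|c' y D' IH].
  by rewrite !(tens0l, tens0r) (linear0 f) (linear0 g).
by rewrite tens_linearr tens_linearl (linearP f) (linearP g) IH fg.
Qed.

Lemma flin2_bilin (f : K -> L -> X) :
  bilin (fun (D : {freeg K / k}) (E : {freeg L / k}) =>
    flin (fun x => flin (f x) E) D).
Proof.
split=> [E a D D'|D a E E']; first exact: linearP.
elim/freeg_ind: D => [|b x D IH]; first by rewrite !linear0 addr0.
by rewrite !linearP /= IH !flinU linearP !scalerDr addrACA !scalerA mulrC.
Qed.

End TensorBasis.

Section SetCompositions.
Variable U : choiceType.
Implicit Types I J R S T : {fset U}.
Local Open Scope fset_scope.

Lemma decompU I S T : decomp I S T -> I = S `|` T.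
Proof. by case/andP=> /eqP. Qed.
Lemma decompl I S T : decomp I S T -> S `<=` I.
Proof. by move/decompU->; rewrite fsubsetUl. Qed.
Lemma decompr I S T : decomp I S T -> T `<=` I.
Proof. by move/decompU->; rewrite fsubsetUr. Qed.

Lemma is_compP I (F : seq {fset U}) : reflect
  [/\ forall B, B \in F -> B != fset0, pairwise (@fdisjoint U) F &
      forall x, (x \in I) = has (fun B : {fset U} => x \in B) F]
  (is_comp I F).
Proof.
have inF x : (x \in \bigcup_(B <- F) B) = has (fun B : {fset U} => x \in B) F.
  apply/bigfcupP/hasP=> [[B /andP[BF _] xB]|[B BF xB]]; exists B => //.
  by rewrite BF.
apply: (iffP and3P) => -[F0 dF FI]; split=> //; first exact/allP.
- by move=> x; rewrite -(eqP FI).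
- exact/allP.
- by apply/eqP/fsetP=> x; rewrite inF FI.
Qed.

Lemma is_comp_sub I (F : seq {fset U}) B : is_comp I F -> B \in F -> B `<=` I.
Proof.
case/is_compP=> _ _ FI BF; apply/fsubsetP=> x xB.
by rewrite FI; apply/hasP; exists B.
Qed.

Lemma is_comp0 : is_comp (fset0 : {fset U}) [::].
Proof. by apply/is_compP; split=> // x; rewrite inE. Qed.

Lemma is_comp1 I : I != fset0 -> is_comp I [:: I].
Proof.
move=> I0; apply/is_compP; split=> // [B|x]; first by rewrite inE => /eqP->.
by rewrite /= orbF.
Qed.

Lemma is_comp_cat I S T (F G : seq {fset U}) :
  decomp I S T -> is_comp S F -> is_comp T G -> is_comp I (F ++ G).
Proof.
case/andP=> /eqP-> dST cF cG.
have [F0 dF FS] := is_compP _ _ cF; have [G0 dG GT] := is_compP _ _ cG.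
apply/is_compP; split=> [B||x].
- by rewrite mem_cat => /orP[/F0|/G0].
- rewrite pairwise_cat dF dG /= andbT; apply/allrelP=> B C BF CG.
  apply: fdisjointWl (is_comp_sub cF BF) _.
  exact: fdisjointWr (is_comp_sub cG CG) _.
- by rewrite has_cat inE FS GT.
Qed.

(* The list of the nonempty sets among I_1 :&: S, ..., I_k :&: S, in order. *)
Definition restr_seq S (F : seq {fset U}) : seq {fset U} :=
  [seq B <- [seq B `&` S | B <- F] | B != fset0].

Lemma is_comp_restr I S F :
  S `<=` I -> is_comp I F -> is_comp S (restr_seq S F).
Proof.
move=> SI /is_compP[F0 dF FI]; apply/is_compP; split=> [B||x].
- by rewrite mem_filter => /andP[].
- apply: pairwise_filter; rewrite pairwise_map; move: dF; apply: sub_pairwise.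
  move=> B C /= dBC; apply: fdisjointWl (fsubsetIl _ _) _.
  exact: fdisjointWr (fsubsetIl _ _) _.
- apply/idP/hasP=> [xS|[B]]; last first.
    by rewrite mem_filter => /andP[_ /mapP[C _ ->]]; rewrite inE => /andP[].
  have := fsubsetP SI _ xS; rewrite FI => /hasP[B BF xB].
  have xBS : x \in B `&` S by rewrite inE xB xS.
  exists (B `&` S) => //; rewrite mem_filter; apply/andP.
  by split; [apply/fset0Pn; exists x | apply/mapP; exists B].
Qed.

Lemma restr_seq_cat S F G :
  restr_seq S (F ++ G) = restr_seq S F ++ restr_seq S G.
Proof. by rewrite /restr_seq map_cat filter_cat. Qed.

Lemma restr_seqI S T F : restr_seq S (restr_seq T F) = restr_seq (T `&` S) F.
Proof.
rewrite /restr_seq; elim: F => //= B F IH.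
rewrite fsetIA -IH; case: ifP => //= /negbFE/eqP->.
by rewrite fset0I eqxx.
Qed.

Lemma restr_seq_id I F : is_comp I F -> restr_seq I F = F.
Proof.
move=> cF; have [F0 _ _] := is_compP _ _ cF; rewrite /restr_seq.
have -> : [seq B `&` I | B <- F] = F.
  apply: map_id_in => B BF; exact/fsetIidPl/(is_comp_sub cF).
by apply/all_filterP/allP.
Qed.

Lemma restr_seqIl I S F : is_comp I F -> restr_seq S F = restr_seq (I `&` S) F.
Proof. by move=> cF; rewrite -restr_seqI (restr_seq_id cF). Qed.

Lemma restr_seq0 F : restr_seq fset0 F = [::].
Proof.
by rewrite /restr_seq; elim: F => //= B F IH; rewrite fsetI0 eqxx.
Qed.

(* The image of A under s, for A contained in I. *)
Definition simg I J (s : I -> J) (A : {fset U}) : {fset U} :=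
  [fset fsval (s x) | x : I & fsval x \in A].

Lemma simgP I J (s : I -> J) A y :
  reflect (exists2 x : I, fsval x \in A & y = fsval (s x)) (y \in simg s A).
Proof.
by apply: (iffP (imfsetP _ _ _ _)) => /= -[x xA ->]; exists x.
Qed.

Lemma simg_in I J (s : I -> J) (bs : bijective s) A (x : I) :
  (fsval (s x) \in simg s A) = (fsval x \in A).
Proof.
apply/simgP/idP=> [[y yA]|xA]; last by exists x.
by move/val_inj/(bij_inj bs)=> ->.
Qed.

Lemma simg_sub I J (s : I -> J) A : simg s A `<=` J.
Proof. by apply/fsubsetP=> _ /simgP[x _ ->]; apply: valP. Qed.

Lemma simg_id I A : A `<=` I -> simg (@id I) A = A.
Proof.
move=> AI; apply/fsetP=> y; apply/simgP/idP=> [[x xA ->] //|yA].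
by exists [` fsubsetP AI _ yA].
Qed.

Lemma simg_comp I J (K : {fset U}) (s : I -> J) (t : J -> K) A : bijective s ->
  simg (t \o s) A = simg t (simg s A).
Proof.
move=> bs; apply/fsetP=> y.
apply/simgP/simgP=> [[x xA ->]|[z /simgP[x xA zx] ->]].
  by exists (s x) => //; rewrite simg_in.
by exists x => //=; rewrite (val_inj zx).
Qed.

Lemma simg_restr I J S S' (s : I -> J) (sS : S -> S') A :
  S `<=` I -> bijective s -> bijective sS -> restricts s sS ->
  simg sS (A `&` S) = simg s A `&` S'.
Proof.
move=> SI bs [sV sK sVK] r; apply/fsetP=> y; rewrite inE.
apply/simgP/andP=> [[x]|[/simgP[x xA ->] sxS']].
  rewrite inE => /andP[xA xS] ->; split; last exact: valP.
  by rewrite (r _ [` fsubsetP SI _ xS]) // simg_in.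
have e : fsval (s x) = fsval (sS (sV [` sxS'])) by rewrite sVK.
exists (sV [` sxS']) => //; rewrite inE fsvalP andbT.
set z := sV _ in e *; rewrite (r z [` fsubsetP SI _ (valP z)] erefl) in e.
by move/val_inj/(bij_inj bs): e xA => ->.
Qed.

Lemma simg_restr_sub I J S S' (s : I -> J) (sS : S -> S') A :
  S `<=` I -> A `<=` S -> restricts s sS -> simg s A = simg sS A.
Proof.
move=> SI AS r; apply/fsetP=> y; apply/simgP/simgP=> -[x xA ->].
  by exists [` fsubsetP AS _ xA] => //; rewrite (r [` fsubsetP AS _ xA] x).
exists [` fsubsetP SI _ (fsvalP x)] => //; exact: r.
Qed.

Lemma is_comp_simg I J (s : I -> J) F : bijective s ->
  is_comp I F -> is_comp J (map (simg s) F).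
Proof.
move=> bs cF; have [F0 dF FI] := is_compP _ _ cF; have [sV sK sVK] := bs.
have simgV A (y : J) : (fsval y \in simg s A) = (fsval (sV y) \in A).
  by rewrite -{1}[y]sVK simg_in.
apply/is_compP; split=> [_ /mapP[B BF ->]||y].
- have /fset0Pn[x xB] := F0 _ BF; apply/fset0Pn.
  exists (fsval (s [` fsubsetP (is_comp_sub cF BF) _ xB])).
  by rewrite simg_in.
- rewrite pairwise_map; move: dF; apply: sub_pairwise => B C /fdisjointP dBC.
  apply/fdisjointP=> _ /simgP[x xB ->]; rewrite simg_in //; exact: dBC.
- rewrite has_map; apply/idP/hasP=> [yJ|[B BF] /(fsubsetP (simg_sub _ _)) //].
  have := valP (sV [` yJ]); rewrite FI => /hasP[B BF yB].
  by exists B => //; rewrite -simgV in yB.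
Qed.

Definition comp_nil : composition fset0 := exist _ [::] is_comp0.
Definition comp_one I (I0 : I != fset0) : composition I :=
  exist _ [:: I] (is_comp1 I0).
Definition comp_cat I S T (d : decomp I S T) (F : composition S)
    (G : composition T) : composition I :=
  exist _ (val F ++ val G) (is_comp_cat d (valP F) (valP G)).
Definition comp_restr I S (SI : S `<=` I) (F : composition I) :
    composition S :=
  exist _ (restr_seq S (val F)) (is_comp_restr SI (valP F)).
Definition comp_map I J (s : I -> J) (bs : bijective s) (F : composition I) :
    composition J :=
  exist _ (map (simg s) (val F)) (is_comp_simg bs (valP F)).

Lemma comp0E (F : composition fset0) : F = comp_nil.
Proof.
case: F => -[|B F] cF; apply: val_inj => //=.
have := is_comp_sub cF (mem_head _ _); rewrite fsubset0 => /eqP B0.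
by have [/(_ B (mem_head _ _))] := is_compP _ _ cF; rewrite B0 eqxx.
Qed.

End SetCompositions.

Section Sigma.
Variables (k : fieldType) (U : choiceType).
Implicit Types I J K R S T : {fset U}.

Definition sigma_obj I : lmodType k := {freeg (composition I) / k}.

(* H_F *)
Definition sigmaH I (F : composition I) : sigma_obj I := << F >>.

Definition sigma_coeff I (z : sigma_obj I) (F : composition I) : k := coeff F z.

Definition sigma_map I J (s : I -> J) (bs : bijective s) :
    {linear sigma_obj I -> sigma_obj J} :=
  flin (fun F => sigmaH (comp_map bs F)).

Lemma sigma_mapE I J (s : I -> J) (bs : bijective s) F :
  sigma_map bs (sigmaH F) = sigmaH (comp_map bs F).
Proof. exact: flinU. Qed.

Lemma sigma_map_id I (b : bijective (@id I)) : sigma_map b =1 id.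
Proof.
apply: (freeg_ext (g := idfun)) => F; rewrite [LHS]sigma_mapE.
congr sigmaH; apply: val_inj => /=; apply: map_id_in => A AF.
exact/simg_id/(is_comp_sub (valP F)).
Qed.

Lemma sigma_map_comp I J K (s : I -> J) (t : J -> K) (bs : bijective s)
    (bt : bijective t) (bts : bijective (t \o s)) :
  sigma_map bts =1 sigma_map bt \o sigma_map bs.
Proof.
apply: freeg_ext => F.
rewrite [LHS]sigma_mapE /= [X in _ = sigma_map _ X]sigma_mapE.
rewrite sigma_mapE; congr sigmaH; apply: val_inj => /=; rewrite -map_comp.
by apply: eq_map => A; apply: simg_comp.
Qed.

Definition sigma_species : species k U :=
  Species sigma_map_id sigma_map_comp.

Definition sigma_mu I S T (d : decomp I S T) :
    {linear tensor (sigma_obj S) (sigma_obj T) -> sigma_obj I} :=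
  tlift (flin2_bilin (fun F G => sigmaH (comp_cat d F G))).

Lemma sigma_muE I S T (d : decomp I S T) F G :
  sigma_mu d (tens (sigmaH F) (sigmaH G)) = sigmaH (comp_cat d F G).
Proof. by rewrite [LHS]tliftE !flinU. Qed.

Definition sigma_iota : {linear k^o -> sigma_obj fset0} :=
  kline (sigmaH (comp_nil U)).

Definition sigma_Delta I S T (d : decomp I S T) :
    {linear sigma_obj I -> tensor (sigma_obj S) (sigma_obj T)} :=
  flin (fun F => tens (sigmaH (comp_restr (decompl d) F))
                      (sigmaH (comp_restr (decompr d) F))).

Lemma sigma_DeltaE I S T (d : decomp I S T) F :
  sigma_Delta d (sigmaH F) = tens (sigmaH (comp_restr (decompl d) F))
                                  (sigmaH (comp_restr (decompr d) F)).
Proof. exact: flinU. Qed.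

Definition sigma_eps : {linear sigma_obj fset0 -> k^o} :=
  flin (fun _ : composition fset0 => 1 : k^o).


Lemma sigma_epsE F : sigma_eps (sigmaH F) = 1.
Proof. exact: flinU. Qed.

Lemma sigma_mu_natural I S T J S' T' (d : decomp I S T) (d' : decomp J S' T')
    (s : I -> J) (sS : S -> S') (sT : T -> T')
    (b : bijective s) (bS : bijective sS) (bT : bijective sT) :
  restricts s sS -> restricts s sT ->
  sigma_map b \o sigma_mu d =1
  sigma_mu d' \o tmap (sigma_map bS) (sigma_map bT).
Proof.
move=> rS rT; apply: tens_basis_ext => F G /=.
rewrite tmapE !sigma_mapE !sigma_muE sigma_mapE; congr sigmaH.
apply: val_inj => /=; rewrite map_cat; congr (_ ++ _).
- apply/eq_in_map => A /(is_comp_sub (valP F)) AS.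
  exact: simg_restr_sub (decompl d) AS rS.
- apply/eq_in_map => A /(is_comp_sub (valP G)) AT.
  exact: simg_restr_sub (decompr d) AT rT.
Qed.

Lemma sigma_mu_assoc I J K R S T (dJ : decomp J R S) (d : decomp I J T)
    (dK : decomp K S T) (d' : decomp I R K) :
  sigma_mu d \o tmap (sigma_mu dJ) idfun =1
  sigma_mu d' \o tmap idfun (sigma_mu dK)
    \o @tassoc k (sigma_obj R) (sigma_obj S) (sigma_obj T).
Proof.
apply: tens_basis_ext3 => F G H /=.
rewrite tassocE !tmapE /= !sigma_muE; congr sigmaH.
by apply: val_inj; rewrite /= catA.
Qed.

Lemma sigma_mu_unitl I (d : decomp I fset0 I) :
  sigma_mu d \o tmap sigma_iota idfun =1 @tlunit k (sigma_obj I).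
Proof.
apply: tensor_ext => a x /=; rewrite tmapE tlunitE /= /kline tensZl linearZ.
congr (_ *: _).
apply: (freeg_ext (f := sigma_mu d \o tens (sigmaH (comp_nil U))) (g := idfun)).
move=> F /=; rewrite [LHS]sigma_muE; congr sigmaH; exact: val_inj.
Qed.


Lemma sigma_mu_unitr I (d : decomp I I fset0) :
  sigma_mu d \o tmap idfun sigma_iota =1 @trunit k (sigma_obj I).
Proof.
apply: tensor_ext => x a /=; rewrite tmapE trunitE /= /kline tensZr linearZ.
congr (_ *: _); rewrite -[tens x _]tswapE.
apply: (freeg_ext (g := idfun)
  (f := sigma_mu d \o @tswap k _ _ \o tens (sigmaH (comp_nil U)))) => F /=.
rewrite tswapE [LHS]sigma_muE; congr sigmaH; apply: val_inj; exact: cats0.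
Qed.

Definition sigma_monoid : monoid_on sigma_species :=
  @MonoidOn k U sigma_species sigma_mu sigma_iota sigma_mu_natural
    sigma_mu_assoc sigma_mu_unitl sigma_mu_unitr.

Lemma sigma_Delta_natural I S T J S' T'
    (d : decomp I S T) (d' : decomp J S' T')
    (s : I -> J) (sS : S -> S') (sT : T -> T')
    (b : bijective s) (bS : bijective sS) (bT : bijective sT) :
  restricts s sS -> restricts s sT ->
  sigma_Delta d' \o sigma_map b =1
  tmap (sigma_map bS) (sigma_map bT) \o sigma_Delta d.
Proof.
move=> rS rT; apply: freeg_ext => F /=.
rewrite sigma_mapE !sigma_DeltaE tmapE !sigma_mapE.
have restr_map (X X' : {fset U}) (sX : X -> X') (G : seq {fset U}) :
    (X `<=` I)%fset -> bijective sX -> restricts s sX ->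
    restr_seq X' (map (simg s) G) = map (simg sX) (restr_seq X G).
  move=> XI bX rX; rewrite /restr_seq; elim: G => //= A G IH.
  rewrite -(simg_restr A XI b bX rX) IH.
  have -> : (simg sX (A `&` X)%fset != fset0) = ((A `&` X)%fset != fset0).
    apply/fset0Pn/fset0Pn=> [[_ /simgP[x xA _]]|[x xA]].
      by exists (fsval x).
    have xX : x \in X by move: xA; rewrite inE => /andP[].
    by exists (fsval (sX [` xX]%fset)); rewrite simg_in.
  by case: ifP.
by congr (tens (sigmaH _) (sigmaH _)); apply: val_inj; apply: restr_map => //;
  [exact: decompl d | exact: decompr d].
Qed.

Lemma sigma_Delta_coassoc I J K R S T (dJ : decomp J R S) (d : decomp I J T)
    (dK : decomp K S T) (d' : decomp I R K) :
  @tassoc k (sigma_obj R) (sigma_obj S) (sigma_obj T)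
    \o tmap (sigma_Delta dJ) idfun \o sigma_Delta d =1
  tmap idfun (sigma_Delta dK) \o sigma_Delta d'.
Proof.
apply: freeg_ext => F /=.
rewrite !sigma_DeltaE !tmapE /= !sigma_DeltaE tassocE.
congr (tens _ (tens _ _)); congr sigmaH; apply: val_inj; rewrite /= ?restr_seqI.
- by have /fsetIidPr-> := decompl dJ.
- by have /fsetIidPr-> := decompr dJ; have /fsetIidPr-> := decompl dK.
- by have /fsetIidPr-> := decompr dK.
Qed.

Lemma sigma_Delta_counitl I (d : decomp I fset0 I) :
  @tlunit k (sigma_obj I) \o tmap sigma_eps idfun \o sigma_Delta d =1 id.
Proof.
apply: (freeg_ext (g := idfun)) => F /=.
rewrite sigma_DeltaE tmapE sigma_epsE tlunitE scale1r; congr sigmaH.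
apply: val_inj; exact: restr_seq_id (valP F).
Qed.

Lemma sigma_Delta_counitr I (d : decomp I I fset0) :
  @trunit k (sigma_obj I) \o tmap idfun sigma_eps \o sigma_Delta d =1 id.
Proof.
apply: (freeg_ext (g := idfun)) => F /=.
rewrite sigma_DeltaE tmapE /= sigma_epsE trunitE scale1r; congr sigmaH.
apply: val_inj; exact: restr_seq_id (valP F).
Qed.

Definition sigma_comonoid : comonoid_on sigma_species :=
  @ComonoidOn k U sigma_species sigma_Delta sigma_eps sigma_Delta_natural
    sigma_Delta_coassoc sigma_Delta_counitl sigma_Delta_counitr.

Lemma decompI I S T S' T' A B C D :
  decomp I S T -> decomp I S' T' -> decomp S A B -> decomp T C D ->
  decomp S' A C -> decomp T' B D ->
  [/\ S `&` S' = A, S `&` T' = B, T `&` S' = C & T `&` T' = D]%fset.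
Proof.
move=> /andP[_ dST] /andP[_ dST'].
move=> /decompU eS /decompU eT /decompU eS' /decompU eT'.
have dis (x : U) : ~~ ((x \in S) && (x \in T)) && ~~ ((x \in S') && (x \in T')).
  apply/andP; split; apply/negP=> /andP[xS]; apply/negP.
    exact: (fdisjointP dST).
  exact: (fdisjointP dST').
split; apply/fsetP=> x; have := dis x; rewrite eS eT eS' eT' !inE;
  by do 4!case: (_ \in _).
Qed.

Lemma sigma_Delta_mu I S T S' T' A B C D
    (d : decomp I S T) (d' : decomp I S' T')
    (dS : decomp S A B) (dT : decomp T C D)
    (dS' : decomp S' A C) (dT' : decomp T' B D) :
  sigma_Delta d' \o sigma_mu d =1
  tmap (sigma_mu dS') (sigma_mu dT') \o @tmid k _ _ _ _
    \o tmap (sigma_Delta dS) (sigma_Delta dT).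
Proof.
have [eA eB eC eD] := decompI d d' dS dT dS' dT'.
apply: tens_basis_ext => F G /=.
rewrite sigma_muE tmapE !sigma_DeltaE tmidE tmapE !sigma_muE.
congr (tens (sigmaH _) (sigmaH _)); apply: val_inj;
  rewrite /= restr_seq_cat (restr_seqIl _ (valP F)) (restr_seqIl _ (valP G)).
  by rewrite eA eC.
by rewrite eB eD.
Qed.

Lemma sigma_Delta_iota (d : decomp fset0 fset0 fset0) :
  sigma_Delta d (sigma_iota 1) = tens (sigma_iota 1) (sigma_iota 1).
Proof.
rewrite /= /kline !scale1r sigma_DeltaE.
by congr (tens (sigmaH _) (sigmaH _)); apply: comp0E.
Qed.

Lemma sigma_eps_mu (d : decomp fset0 fset0 fset0) :
  sigma_eps \o sigma_mu d =1 @tlunit k k^o \o tmap sigma_eps sigma_eps.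
Proof.
apply: tens_basis_ext => F G /=.
by rewrite sigma_muE tmapE !sigma_epsE tlunitE scale1r.
Qed.

Lemma sigma_eps_iota : sigma_eps \o sigma_iota =1 id.
Proof.
by move=> a; rewrite /= /kline linearZ /= sigma_epsE; apply: mulr1.
Qed.

Definition sigma : bimonoid k U :=
  @Bimonoid k U sigma_species sigma_monoid sigma_comonoid sigma_Delta_mu
    sigma_Delta_iota sigma_eps_mu sigma_eps_iota.

Lemma sigma_connected : connected sigma.
Proof.
exists (sigmaH (comp_nil U)); first by rewrite freegU_eq0 oner_eq0.
elim/freeg_ind=> [|a F D [b ->]]; first by exists 0; rewrite scale0r.
by exists (a + b); rewrite (comp0E F) scalerDl.
Qed.

End Sigma.

Section Psi.
Variables (k : fieldType) (U : choiceType) (h : bimonoid k U) (I : {fset U}).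

(* dom z is the finite set of all F with a_F != 0. *)
Definition Psi (z : sigma k U I) (x : h I) : h I :=
  \sum_(F <- dom (z : {freeg (composition I) / k}))
    sigma_coeff z F *: mu_comp h F (Delta_comp h F x).

Lemma Psi_is_linear z : linear (Psi z).
Proof.
move=> a x y; rewrite /Psi scaler_sumr -big_split; apply: eq_bigr => F _ /=.
rewrite (linearP (Delta_comp h F)) (linearP (mu_comp h F)).
by rewrite scalerDr !scalerA mulrC.
Qed.

HB.instance Definition _ z :=
  GRing.isLinear.Build k (h I) (h I) _ (Psi z) (Psi_is_linear z).

End Psi.
Arguments Psi {k U} h {I} z x.

Definition projection_onto (k : fieldType) (V : lmodType k)
    (f : {linear V -> V}) (P : V -> Prop) : Prop :=
  f \o f =1 f /\ forall y, P y <-> exists x, f x = y.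

(* Main.v *)
(* Write psi_F = mu_F Delta_F.  The bimonoid axiom and cocommutativity give
   Delta_{S,T} psi_F = (psi_{F|S} (x) psi_{F|T}) Delta_{S,T} for every
   decomposition I = S |_| T.  Hence Delta_{S,T} (Psi z x) is obtained from
   Delta_{S,T} z by a linear map depending on Delta_{S,T} x, and vanishes with
   it; this is (i).  If x is primitive, psi_F kills x as soon as F has at least
   two blocks, so Psi z x = a_(I) x, and (ii) follows. *)

Require Import Defs.
From mathcomp Require Import all_boot all_order all_algebra finmap.
From mathcomp Require Import freeg.

Local Open Scope ring_scope.

Set Implicit Arguments.
Unset Strict Implicit.
Unset Printing Implicit Defensive.

Import GRing.Theory.

(** * Functoriality of the tensor product and naturality of its structure maps *)

Section TensorFunctor.
Variable k : fieldType.
Implicit Types V W X Y : lmodType k.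

Lemma eq_tmap V W X Y (f f' : {linear V -> X}) (g g' : {linear W -> Y}) :
  f =1 f' -> g =1 g' -> tmap f g =1 tmap f' g'.
Proof. by move=> ff gg; apply: tensor_ext => v w /=; rewrite !tmapE ff gg. Qed.

Lemma tmap_comp V W V' W' X Y (f : {linear V' -> X}) (g : {linear W' -> Y})
    (f' : {linear V -> V'}) (g' : {linear W -> W'}) t :
  tmap f g (tmap f' g' t) = tmap (f \o f') (g \o g') t.
Proof.
by apply: (tensor_ext (f := tmap f g \o tmap f' g')) => v w /=; rewrite !tmapE.
Qed.

Lemma tmap_id V W : @tmap k V W V W idfun idfun =1 id.
Proof. by apply: (tensor_ext (g := idfun)) => v w; rewrite [LHS]tmapE. Qed.

Lemma tens3_ext V W X Y (f g : {linear tensor (tensor V W) X -> Y}) :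
  (forall v w x, f (tens (tens v w) x) = g (tens (tens v w) x)) -> f =1 g.
Proof.
move=> fg; apply: tensor_ext => t x.
rewrite -![tens t x]tswapE.
apply: (tensor_ext (f := f \o @tswap k X _ \o tens x)
                   (g := g \o @tswap k X _ \o tens x)) => v w /=.
by rewrite !tswapE.
Qed.

Lemma tassocK V W X (t : tensor (tensor V W) X) : tassocV (tassoc t) = t.
Proof.
apply: (tens3_ext (f := @tassocV k V W X \o @tassoc k V W X) (g := idfun)).
by move=> v w x /=; rewrite tassocE tassocVE.
Qed.

Lemma tassoc_natural V W X V' W' X' (f : {linear V -> V'})
    (g : {linear W -> W'}) (e : {linear X -> X'}) t :
  tassoc (tmap (tmap f g) e t) = tmap f (tmap g e) (tassoc t).
Proof.
apply: (tens3_ext (f := @tassoc k _ _ _ \o tmap (tmap f g) e)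
                  (g := tmap f (tmap g e) \o @tassoc k _ _ _)).
by move=> v w x /=; rewrite tmapE /= tmapE !tassocE !tmapE /= tmapE.
Qed.

Lemma tmid_natural V W X Y V' W' X' Y' (f : {linear V -> V'})
    (g : {linear W -> W'}) (e : {linear X -> X'}) (j : {linear Y -> Y'}) t :
  tmid (tmap (tmap f g) (tmap e j) t) = tmap (tmap f e) (tmap g j) (tmid t).
Proof.
apply: (tens3_ext (f := @tmid k _ _ _ _ \o tmap (tmap f g) (tmap e j))
  (g := tmap (tmap f e) (tmap g j) \o @tmid k _ _ _ _)) => v w u /=.
rewrite tmapE /= tmapE.
apply: (tensor_ext
  (f := @tmid k _ _ _ _ \o tens (tens (f v) (g w)) \o tmap e j)
  (g := tmap (tmap f e) (tmap g j) \o @tmid k _ _ _ _ \o tens (tens v w))).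
by move=> x y /=; rewrite tmapE !tmidE tmapE /= !tmapE.
Qed.

(** Once both sides are reassociated, only the swap of the two middle factors separates them;
    [tassocV] then cancels [tassoc] inside and outside. *)
Lemma tmid_tassoc (K V W X Y : lmodType k) (u : tensor V K)
    (f : {linear K -> tensor (tensor W X) Y}) t1 t2 :
  tassoc t1 = tmap idfun (@tassoc k W X Y \o f) u ->
  tassoc t2 =
    tmap idfun (@tassoc k X W Y \o (tmap (@tswap k W X) idfun \o f)) u ->
  tmid t1 = t2.
Proof.
move=> e1 e2; rewrite -[RHS]tassocK e2 /tmid /= e1 tmap_comp; congr tassocV.
by apply: eq_tmap => // y /=; rewrite tassocK.
Qed.

End TensorFunctor.

(** * Decompositions of finite sets, tested pointwise *)

Section Decompositions.
Variable U : choiceType.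
Implicit Types I S T : {fset U}.
Local Open Scope fset_scope.

Lemma decompP I S T : reflect
  (forall x, ((x \in I) == (x \in S) || (x \in T)) &&
             ~~ ((x \in S) && (x \in T)))
  (decomp I S T).
Proof.
apply: (iffP andP) => [[/eqP-> /fdisjointP dST] x|dST].
  by rewrite inE eqxx /=; apply/andP=> -[/dST/negP].
split; last first.
  by apply/fdisjointP=> x xS; have /andP[_] := dST x; rewrite xS.
by apply/eqP/fsetP=> x; rewrite inE; have /andP[/eqP] := dST x.
Qed.

Lemma decomp_ID I S : decomp I (I `&` S) (I `\` S).
Proof. by apply/decompP=> x; rewrite !inE; do !case: (_ \in _). Qed.

Lemma decomp_setI I S T J :
  decomp I S T -> J `<=` I -> decomp J (J `&` S) (J `&` T).
Proof.
move=> /decompP d /fsubsetP JI; apply/decompP=> x; rewrite !inE.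
by move: (d x) (introT implyP (JI x)); do 4!case: (x \in _).
Qed.

End Decompositions.

(** * The operators psi_F and their compatibility with the coproduct *)

Section BlockOperators.
Variables (k : fieldType) (U : choiceType) (h : bimonoid k U).
Implicit Types I J K S T : {fset U}.
Local Open Scope fset_scope.

Lemma Delta_coassoc_tmap (V : lmodType k) I J K R S T (dJ : decomp J R S)
    (d : decomp I J T) (dK : decomp K S T) (d' : decomp I R K)
    (g : {linear h T -> V}) x :
  tassoc (tmap (Delta h dJ) g (Delta h d x)) =
  tmap idfun (tmap idfun g \o Delta h dK) (Delta h d' x).
Proof.
have /= e := Delta_coassoc h dJ d dK d' x.
rewrite -[RHS](tmap_comp idfun (tmap idfun g) idfun (Delta h dK)) -e.
rewrite -tassoc_natural tmap_comp; congr tassoc.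
by apply: eq_tmap => // y /=; rewrite tmap_id.
Qed.

(* By coassociativity and cocommutativity both sides are the iterated
   coproduct along (A, C, B, D). *)
Lemma Delta_interchange : cocommutative h ->
  forall I P Q S T A B C D (dPQ : decomp I P Q) (dST : decomp I S T)
    (dP : decomp P A B) (dQ : decomp Q C D)
    (dS : decomp S A C) (dT : decomp T B D),
  @tmid k _ _ _ _ \o tmap (Delta h dP) (Delta h dQ) \o Delta h dPQ =1
  tmap (Delta h dS) (Delta h dT) \o Delta h dST.
Proof.
move=> hC I P Q S T A B C D dPQ dST dP dQ dS dT x /=.
(* Splitting [I] into [A], [L], [D] is common to both sides; they differ only in the order in which
   [L] is split. *)
pose K := B `|` Q; pose L := B `|` C.
have [dK dBQ dCT dLD dBC] : [/\ decomp I A K, decomp K B Q, decomp K C T,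
    decomp K L D & decomp L B C].
  split; apply/decompP=> y; rewrite !inE;
    move: (elimT (decompP _ _ _) dPQ y) (elimT (decompP _ _ _) dST y)
      (elimT (decompP _ _ _) dP y) (elimT (decompP _ _ _) dQ y)
      (elimT (decompP _ _ _) dS y) (elimT (decompP _ _ _) dT y);
    by do 9!case: (y \in _).
have dCB : decomp L C B by move: dBC; rewrite /decomp fsetUC fdisjoint_sym.
apply: (tmid_tassoc (u := Delta h dK x)
  (f := tmap (Delta h dBC) idfun \o Delta h dLD)).
- rewrite (Delta_coassoc_tmap _ _ dBQ dK); apply: eq_tmap => // y.
  exact: esym (Delta_coassoc h dBC dLD dQ dBQ y).
- rewrite (Delta_coassoc_tmap _ _ dCT dK); apply: eq_tmap => // y.
  apply: etrans (esym (Delta_coassoc h dCB dLD dT dCT y)) _.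
  rewrite /= tmap_comp; congr tassoc; apply: eq_tmap => // w /=.
  exact: hC.
Qed.

(* On a composition F of I this is mu_F Delta_F.  It makes sense for every
   sequence F, blocks being truncated to I, so that restricting F to a subset
   changes nothing. *)
Fixpoint block_op (F : seq {fset U}) I : {linear h I -> h I} :=
  match F with
  | [::] => idfun
  | B :: F' => mu h (decomp_ID I B)
      \o tmap idfun (block_op F' (I `\` B)) \o Delta h (decomp_ID I B)
  end.

(** Admits any sets equal to the two canonical pieces, so that later arguments need no transport
    between the spaces [h S]. *)
Lemma block_op_cons B F I S T (d : decomp I S T) x :
  S = I `&` B -> T = I `\` B ->
  block_op (B :: F) I x = mu h d (tmap idfun (block_op F T) (Delta h d x)).
Proof.
by move=> eS eT; subst S T; rewrite (bool_irrelevance d (decomp_ID I B)).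
Qed.

(** Induction on [F]: [Delta_mu] moves the coproduct past the product for the first block, the
    induction hypothesis moves it past the remaining blocks, and [Delta_interchange] reorders the
    resulting fourfold coproduct. *)
Lemma Delta_block_op : cocommutative h ->
  forall F I S T (d : decomp I S T),
  Delta h d \o block_op F I =1
  tmap (block_op F S) (block_op F T) \o Delta h d.
Proof.
move=> hC; elim=> [|B F IH] I S T d x /=; first by rewrite tmap_id.
have dB := decomp_setI d (fsubsetIl I B).
have dD := decomp_setI d (fsubsetDl I B).
have [/fsubsetP SI /fsubsetP TI] := (decompl d, decompr d).
have eS : I `&` B `&` S = S `&` B.
  by apply/fsetP=> y; rewrite !inE; have /implyP := SI y; do 3!case: (y \in _).
have eT : I `&` B `&` T = T `&` B.
  by apply/fsetP=> y; rewrite !inE; have /implyP := TI y; do 3!case: (y \in _).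
have eS' : (I `\` B) `&` S = S `\` B.
  by apply/fsetP=> y; rewrite !inE; have /implyP := SI y; do 3!case: (y \in _).
have eT' : (I `\` B) `&` T = T `\` B.
  by apply/fsetP=> y; rewrite !inE; have /implyP := TI y; do 3!case: (y \in _).
rewrite eS eT in dB; rewrite eS' eT' in dD.
have /= -> := Delta_mu (decomp_ID I B) d dB dD (decomp_ID S B) (decomp_ID T B)
  (tmap idfun (block_op F (I `\` B)) (Delta h (decomp_ID I B) x)).
rewrite tmap_comp.
have -> : tmap (Delta h dB \o idfun) (Delta h dD \o block_op F (I `\` B))
    (Delta h (decomp_ID I B) x) =
  tmap (tmap idfun idfun) (tmap (block_op F (S `\` B)) (block_op F (T `\` B)))
    (tmap (Delta h dB) (Delta h dD) (Delta h (decomp_ID I B) x)).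
  by rewrite tmap_comp; apply: eq_tmap => y /=; [rewrite tmap_id | exact: IH].
rewrite tmid_natural.
have /= -> := Delta_interchange hC (decomp_ID I B) d dB dD
  (decomp_ID S B) (decomp_ID T B) x.
by rewrite !tmap_comp; apply: eq_tmap.
Qed.

(** * Empty pieces are harmless in the connected case *)

Section Connected.
Hypothesis hconn : connected h.

(** The counit sends [iota0 h 1] to 1, so this vector is nonzero and spans the line [h fset0];
    checking the identity on it suffices. *)
Lemma iota_eps (x : h fset0) : iota0 h (eps0 h x) = x.
Proof.
have [e e0 he] := hconn; have [c ec] := he (iota0 h 1).
have /= i1 := eps_iota h 1.
have c0 : c != 0.
  apply: contraTneq (oner_neq0 k) => c0.
  by rewrite negbK -i1 ec c0 scale0r linear0.
have [a ->] := he x.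
have -> : a *: e = (a / c) *: iota0 h 1 by rewrite ec scalerA divfK.
by rewrite linearZ /= i1 linearZ.
Qed.

(** Inserting unit after counit on the empty factor reduces the claim to the unit and counit
    laws. *)
Lemma mu_Delta_set0r I S (d : decomp I S fset0) x : mu h d (Delta h d x) = x.
Proof.
have eS : S = I by rewrite (decompU d) fsetU0.
subst S; have /= r := Delta_counitr h d x; rewrite -[RHS]r.
rewrite -(mu_unitr h d) /= tmap_comp; congr (mu h d _).
by rewrite -[LHS]tmap_id; apply: eq_tmap => // y; rewrite /= iota_eps.
Qed.

Lemma mu_Delta_set0l I (d : decomp I fset0 I) (f : {linear h I -> h I}) x :
  mu h d (tmap idfun f (Delta h d x)) = f x.
Proof.
have /= r := Delta_counitl h d x; rewrite -[in RHS]r.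
set t := Delta h d x.
have -> : tmap idfun f t =
    tmap (iota0 h) idfun (tmap idfun f (tmap (eps0 h) idfun t)).
  by rewrite !tmap_comp; apply: eq_tmap => // y; rewrite /= iota_eps.
have /= -> := mu_unitl h d (tmap idfun f (tmap (eps0 h) idfun t)).
apply: (tensor_ext (f := @tlunit k _ \o tmap idfun f)
                   (g := f \o @tlunit k _)) => a y /=.
by rewrite tmapE !tlunitE linearZ.
Qed.

Lemma block_op_disjoint B F I : [disjoint I & B] ->
  block_op (B :: F) I =1 block_op F I.
Proof.
move=> dIB x.
have d : decomp I fset0 I by rewrite /decomp fset0U eqxx fdisjoint0X.
rewrite (@block_op_cons B F _ _ _ d x) ?mu_Delta_set0l //.
- by apply/esym/eqP.
- by apply/esym/fsetDidPl.
Qed.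

(** Truncating a block to [S] does not change its trace on [I], and a block dropped by [restr_seq]
    misses [I], hence acts trivially. *)
Lemma block_op_restr F I S : I `<=` S ->
  block_op (restr_seq S F) I =1 block_op F I.
Proof.
elim: F I => //= B F IH I IS x.
have IB : I `&` (B `&` S) = I `&` B.
  by rewrite fsetIA; apply/fsetIidPl/(fsubset_trans (fsubsetIl _ _)).
have DB : I `\` (B `&` S) = I `\` B.
  by move: IS; rewrite fsetDIr -fsetD_eq0 => /eqP->; rewrite fsetU0.
rewrite /restr_seq /=; case: ifPn => [_|/negbNE/eqP BS].
  rewrite (@block_op_cons _ _ _ _ _ (decomp_ID I B)) //.
  congr (mu h _ _); apply: eq_tmap => // y; apply: IH.
  exact: fsubset_trans (fsubsetDl _ _) IS.
rewrite -[RHS]/(block_op (B :: F) I x) block_op_disjoint ?IH //.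
by rewrite /fdisjoint -IB BS fsetI0.
Qed.

Lemma block_op_id I : block_op [:: I] I =1 id.
Proof.
move=> x.
have d : decomp I I fset0 by rewrite /decomp fsetU0 eqxx fdisjointX0.
rewrite (@block_op_cons _ _ _ _ _ d) ?fsetIid ?fsetDv //.
by rewrite tmap_id mu_Delta_set0r.
Qed.

(** The two sides differ only at the end of [F]: [mu_seq] stops at the last block, while [block_op]
    still splits off an empty remainder. *)
Lemma mu_Delta_seq F I (c : is_comp I F) x :
  mu_seq h c (Delta_seq h c x) = block_op F I x.
Proof.
elim: F I c x => [|B [|B' F] IH] I c x.
- rewrite /=; move: (is_comp_nil c) => e; case: _ / e x => x.
  exact: iota_eps.
- have BI := is_comp_seq1 c; subst B.
  by rewrite block_op_id /= (eq_irrelevance (is_comp_seq1 c) erefl).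
- rewrite (@block_op_cons _ _ _ _ _ (is_comp_decomp c)) //; last first.
    by apply/esym/fsetIidPr/(decompl (is_comp_decomp c)).
  rewrite [LHS]/= tmap_comp; congr (mu h _ _); apply: eq_tmap => // y.
  exact: (IH _ (is_comp_behead c)).
Qed.

(** * The action of [sigma] on [h] and its effect on primitive elements *)

Lemma Psi_block_op I (z : sigma k U I) x :
  Psi h z x = flin (fun F : composition I => block_op (val F) I x) z.
Proof.
by rewrite flinE; apply: eq_bigr => F _; congr (_ *: _); apply: mu_Delta_seq.
Qed.

Lemma Delta_Psi : cocommutative h ->
  forall I (z : sigma k U I) S T (d : decomp I S T) x,
  Delta (sigma k U) d z = 0 -> Delta h d (Psi h z x) = 0.
Proof.
move=> hC I z S T d x z0; rewrite Psi_block_op.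
(* With [x] fixed, [theta] carries the coproduct of any element of [sigma] to the coproduct of its
   action on [x]; this is checked on the basis. *)
pose theta := tlift (flin2_bilin (fun (F : composition S) (G : composition T) =>
  tmap (block_op (val F) S) (block_op (val G) T) (Delta h d x))).
rewrite -(linear0 theta) -z0.
apply: (freeg_ext (f := Delta h d \o flin _)
                  (g := theta \o Delta (sigma k U) d)) => F /=.
rewrite flinU sigma_DeltaE /theta tliftE !flinU.
have /= -> := Delta_block_op hC (val F) d x.
by apply: eq_tmap => y; rewrite /= block_op_restr.
Qed.

Lemma primitive_Psi I : cocommutative h ->
  forall z : sigma k U I, primitive (sigma k U) z ->
  forall x, primitive h (Psi h z x).
Proof. by move=> hC z Pz x S T d S0 T0; apply: Delta_Psi => //; apply: Pz. Qed.

Lemma Psi_primitive I (I0 : I != fset0) (z : sigma k U I) x :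
  primitive h x -> Psi h z x = sigma_coeff z (comp_one I0) *: x.
Proof.
move=> Px; rewrite Psi_block_op /sigma_coeff; elim/freeg_ind: z => [|a F D IH].
  by rewrite linear0 coeff0 scale0r.
rewrite linearP /= flinU IH coeffD coeffZ coeffU mul1r scalerDl -scalerA.
congr (_ *: _ + _)%R; case: F => F cF; rewrite -val_eqE /= eq_sym.
case: F cF => [|B [|B' F]] cF.
- by have /esym/eqP := is_comp_nil cF; rewrite (negPf I0).
- by have BI := is_comp_seq1 cF; subst B; rewrite block_op_id eqxx scale1r.
- rewrite (@block_op_cons _ _ _ _ _ (is_comp_decomp cF)) //; last first.
    by apply/esym/fsetIidPr/(decompl (is_comp_decomp cF)).
  have := cF; rewrite is_comp_cons => /and3P[B0 _ cT].
  have := cT; rewrite is_comp_cons => /and3P[B'0 d _].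
  (* The remainder contains the nonempty block [B'], so primitivity of [x] applies to the splitting
     into [B] and its complement. *)
  have I'0 : I `\` B != fset0.
    apply: contraNneq B'0 => I'0; rewrite -fsubset0 -I'0; exact: decompl d.
  rewrite eqseq_cons andbF scale0r (Px _ _ _ B0 I'0).
  by rewrite (linear0 (tmap _ _)) (linear0 (mu h _)).
Qed.

End Connected.
End BlockOperators.

Theorem theorem90 (k : fieldType) (U : choiceType) (h : bimonoid k U)
  (h_cocommutative : cocommutative h) (h_connected : connected h)
  (I : {fset U}) (I_neq0 : I != fset0) (z : sigma k U I) :
  (primitive (sigma k U) z ->
    forall x : h I, primitive h (Psi h z x)) /\
  (primitive (sigma k U) z ->
    sigma_coeff z (comp_one I_neq0) != 0 ->
    projection_onto (Psi h ((sigma_coeff z (comp_one I_neq0))^-1 *: z))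
      (fun y : h I => primitive h y)).
Proof.
split=> [Pz|Pz a0]; first exact: primitive_Psi.
set a := sigma_coeff _ _ in a0 *.
have PaE y : primitive h y -> Psi h (a^-1 *: z) y = y.
  move=> Py; rewrite (Psi_primitive h_connected I_neq0 _ Py).
  by rewrite /sigma_coeff coeffZ mulVf ?scale1r.
have aP y : primitive h (Psi h (a^-1 *: z) y).
  apply: primitive_Psi => // S T d S0 T0.
  by rewrite linearZ /= Pz // scaler0.
(* Values are primitive and primitive elements are fixed: this gives both idempotence and the
   image. *)
split=> [y|y]; first exact/PaE/aP.
by split=> [Py|[x <-]]; [exists y; apply: PaE | apply: aP].
Qed.
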